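(* Let $\alpha>-1$ and define polynomials $a_i(x)$, $i=1,2,3,\ldots$, by $$a_i(x)=\frac{1}{i!}\sum_{j=1}^{i}(-1)^{i+j+1}\binom{\alpha+1}{j-1}\binom{\alpha+2}{i-j}(\alpha+3)_{i-j}\,x^j .$$ Then $$\sum_{i=1}^{\infty}a_i(x)=-\frac{\sin\pi\alpha}{\pi}\,\frac{x}{(\alpha+2)(\alpha+3)}\;{}_1F_1\!\left(\begin{matrix}1\\ \alpha+4\end{matrix};-x\right),\qquad \alpha>-1 .$$ Moreover, if $\alpha$ is a nonnegative integer, then for every $k=1,2,3,\ldots$ $$\sum_{i=k}^{\infty}\binom{i}{k}a_i(x)=(-1)^{\alpha+k}a_k(-x).$$
   Context: Here $(c)_m=c(c+1)\cdots(c+m-1)$ is the Pochhammer symbol, $\binom{a}{m}=\frac{a(a-1)\cdots(a-m+1)}{m!}$ is the generalized binomial coefficient for real $a$ and nonnegative integer $m$, and ${}_1F_1$ is the confluent hypergeometric function ${}_1F_1(a;b;z)=\sum_{m\ge0}\frac{(a)_m}{(b)_m m!}z^m$. (These $a_i(x)$ are the coefficients of the infinite order differential equation $M\sum_{i\ge0}a_i(x)y^{(i)}(x)+xy''(x)+(\alpha+1-x)y'(x)+ny(x)=0$ satisfied by the generalized Laguerre polynomials $L_n^{\alpha,M}(x)$ orthogonal with respect to $\frac{1}{\Gamma(\alpha+1)}x^\alpha e^{-x}$ on $[0,\infty)$ plus a point mass $M$ at $0$.) *)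

(* Defs.v *)
From Stdlib Require Import Reals Arith Factorial.
From Coquelicot Require Import Coquelicot.
Open Scope R_scope.

Fixpoint poch (c : R) (m : nat) : R :=
  match m with
  | O => 1
  | S m' => poch c m' * (c + INR m')
  end.

Fixpoint falling (a : R) (m : nat) : R :=
  match m with
  | O => 1
  | S m' => falling a m' * (a - INR m')
  end.

Definition gbinom (a : R) (m : nat) : R := falling a m / INR (Factorial.fact m).

Definition acoef (al : R) (i : nat) (x : R) : R :=
  / INR (Factorial.fact i) *
  sum_n_m (fun j => (-1) ^ (i + j + 1) * gbinom (al + 1) (j - 1)
                    * gbinom (al + 2) (i - j) * poch (al + 3) (i - j) * x ^ j)
          1 i.

Definition hyp1F1 (a b z : R) : R :=
  Series (fun m => poch a m / (poch b m * INR (Factorial.fact m)) * z ^ m).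

(* Main.v *)
Require Import Defs.
From Stdlib Require Import Reals Arith Factorial Lra Lia.
From Coquelicot Require Import Coquelicot.
Open Scope R_scope.

(** Put b = alpha + 2 and w_m = (-b)_m (b+1)_m / m!.  Then a_i(x) is the sum over j + m = i, j >= 1, of
    - binom(b-1, j-1) x^j w_m / (m+j)!, so summing over i leads to G_j = sum_m w_m / (m+j)!, a Gauss
    hypergeometric series at 1.  Gosper telescoping of m w_m / (m+j)! gives
    (j(j+1) - b(b+1)) G_(j+1) = j G_j, and for j = 0 it expresses the partial sums of G_1 by Euler's
    partial products for sin(pi b); hence binom(b-1, j-1) G_j is known in closed form.  The exchange of
    summations is dominated by a product p_j q_m.  The sine product comes from the recurrence
    satisfied by the integrals of cos(2zt) cos^n t over [0, pi/2].

    For alpha = n everything is finite, and the coefficient of x^j in the second identity is the same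
    kind of sum with 1/(m+j-k)! instead of 1/(m+j)!.  The same recurrence, read for negative
    indices, determines it from the trivial case where a single term survives. *)

(** * Cosine integrals and Euler's product for the sine *)

Definition cosint (z : R) (n : nat) : R :=
  RInt (fun t => cos (2 * z * t) * cos t ^ n) 0 (PI / 2).

Lemma continuous_cosint z n t :
  continuous (fun t => cos (2 * z * t) * cos t ^ n) t.
Proof.
  apply (ex_derive_continuous (fun t => cos (2 * z * t) * cos t ^ n)).
  auto_derive; auto.
Qed.

Lemma ex_RInt_cosint z n :
  ex_RInt (fun t => cos (2 * z * t) * cos t ^ n) 0 (PI / 2).
Proof. apply (ex_RInt_continuous (V := R_CompleteNormedModule)); intros; apply continuous_cosint. Qed.

(** Two integrations by parts. Dividing the case of even [n + 2 = 2m] by the same case at [z = 0]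
    produces the factor [1 - z^2 / m^2] of the sine product. *)
Lemma cosint_rec z n :
  (INR (n + 2) ^ 2 - 4 * z ^ 2) * cosint z (n + 2) =
  INR (n + 2) * INR (n + 1) * cosint z n.
Proof.
  unfold cosint.
  (* [F] vanishes at both endpoints, and its derivative [dF] is the difference of the integrands. *)
  pose (F := fun t => INR (n + 2) * cos (2 * z * t) * cos t ^ (n + 1) * sin t
                      - 2 * z * sin (2 * z * t) * cos t ^ (n + 2)).
  pose (f2 := fun t => cos (2 * z * t) * cos t ^ (n + 2)).
  pose (f0 := fun t => cos (2 * z * t) * cos t ^ n).
  pose (dF := fun t => minus (scal (INR (n + 2) ^ 2 - 4 * z ^ 2) (f2 t))
                         (scal (INR (n + 2) * INR (n + 1)) (f0 t))).
  assert (HF : is_RInt dF 0 (PI / 2) (minus (F (PI / 2)) (F 0))).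
  { apply (is_RInt_derive (V := R_CompleteNormedModule) F dF).
    - intros t _. unfold F. auto_derive; [auto|].
      unfold dF, f2, f0, minus, scal, plus, opp; simpl; unfold mult; simpl.
      replace (Init.Nat.pred (n + 1)) with n by lia.
      replace (Init.Nat.pred (n + 2)) with (n + 1)%nat by lia.
      rewrite !pow_add, !plus_INR; simpl.
      pose proof (sin2_cos2 t) as H; unfold Rsqr in H.
      set (s := sin t) in *; set (c := cos t) in *.
      set (C := cos (2 * z * t)); set (S := sin (2 * z * t)).
      set (p := c ^ n); set (m := INR n).
      assert (Hs : s * s = 1 - c * c) by lra.
      transitivity (C * p * ((m + 2) * c * c - (m + 2) * (m + 1) * (s * s) - 4 * z * z * (c * c))).
      { ring. }
      rewrite Hs. ring.
    - intros t _.
      apply (ex_derive_continuous dF).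
      unfold dF, f2, f0, minus, scal, plus, opp; simpl; unfold mult; simpl.
      auto_derive; auto. }
  assert (HF0 : minus (F (PI / 2)) (F 0) = 0).
  { unfold F, minus, plus, opp; simpl. rewrite cos_PI2, Rmult_0_r, sin_0.
    rewrite !pow_ne_zero by lia. ring. }
  rewrite HF0 in HF.
  pose proof (is_RInt_minus _ _ _ _ _ _
    (is_RInt_scal f2 _ _ (INR (n + 2) ^ 2 - 4 * z ^ 2) _ (RInt_correct _ _ _ (ex_RInt_cosint z (n + 2))))
    (is_RInt_scal f0 _ _ (INR (n + 2) * INR (n + 1)) _ (RInt_correct _ _ _ (ex_RInt_cosint z n)))) as H.
  apply (is_RInt_unique (V := R_CompleteNormedModule)) in H, HF.
  change (RInt dF 0 (PI / 2) =
     (INR (n + 2) ^ 2 - 4 * z ^ 2) * RInt f2 0 (PI / 2)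
     - INR (n + 2) * INR (n + 1) * RInt f0 0 (PI / 2)) in H.
  change ((INR (n + 2) ^ 2 - 4 * z ^ 2) * RInt f2 0 (PI / 2)
     = INR (n + 2) * INR (n + 1) * RInt f0 0 (PI / 2)). lra.
Qed.

Lemma cosint_0_even_pos N : 0 < cosint 0 (2 * N).
Proof.
  induction N as [|N IH].
  - unfold cosint. rewrite (RInt_ext _ (fun _ => 1)).
    + rewrite RInt_const. unfold scal; simpl; unfold mult; simpl.
      pose proof PI_RGT_0; lra.
    + intros t _. simpl. rewrite Rmult_0_r, Rmult_0_l, cos_0. ring.
  - pose proof (cosint_rec 0 (2 * N)) as H.
    replace (2 * S N)%nat with (2 * N + 2)%nat by lia.
    assert (0 < INR (2 * N + 2)) by (apply lt_0_INR; lia).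
    assert (0 < INR (2 * N + 1)) by (apply lt_0_INR; lia).
    apply Rmult_lt_reg_l with (INR (2 * N + 2) ^ 2); [nra|].
    rewrite Rmult_0_r.
    replace (INR (2 * N + 2) ^ 2) with (INR (2 * N + 2) ^ 2 - 4 * 0 ^ 2) by ring.
    rewrite H. apply Rmult_lt_0_compat; [nra|assumption].
Qed.

Lemma cosint_0_eq : cosint 0 0 = PI / 2.
Proof.
  unfold cosint. rewrite (RInt_ext _ (fun _ => 1)).
  - rewrite RInt_const. unfold scal; simpl; unfold mult; simpl. lra.
  - intros t _. simpl. rewrite Rmult_0_r, Rmult_0_l, cos_0. ring.
Qed.

Lemma cosint_eq z : z <> 0 -> cosint z 0 = sin (PI * z) / (2 * z).
Proof.
  intros Hz. unfold cosint. apply is_RInt_unique.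
  replace (sin (PI * z) / (2 * z)) with
    (minus (sin (2 * z * (PI / 2)) / (2 * z)) (sin (2 * z * 0) / (2 * z))).
  - apply (is_RInt_derive (V := R_CompleteNormedModule) (fun t => sin (2 * z * t) / (2 * z))).
    + intros t _. auto_derive; [auto|]. simpl; field; auto.
    + intros t _. apply continuous_cosint.
  - unfold minus, plus, opp; simpl. rewrite Rmult_0_r, sin_0.
    replace (2 * z * (PI / 2)) with (PI * z) by field. field; auto.
Qed.

Lemma sin_sqr_le x : sin x ^ 2 <= x ^ 2.
Proof.
  destruct (MVT_gen sin 0 x cos) as (c & _ & Hc).
  - intros; apply is_derive_sin.
  - intros; apply continuity_sin.
  - rewrite sin_0, !Rminus_0_r in Hc. rewrite Hc.
    pose proof (sin2_cos2 c) as H; unfold Rsqr in H.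
    rewrite Rpow_mult_distr.
    assert (cos c ^ 2 <= 1) by nra. pose proof (pow2_ge_0 x). nra.
Qed.

(** The derivative of [sin t - t cos t] is [t sin t], which is nonnegative here. *)
Lemma mul_cos_le_sin t : 0 <= t <= PI / 2 -> 0 <= t * cos t <= sin t.
Proof.
  intros Ht. pose proof PI_RGT_0. split.
  - apply Rmult_le_pos; [lra|apply cos_ge_0; lra].
  - destruct (MVT_gen (fun t => sin t - t * cos t) 0 t (fun t => t * sin t)) as (c & Hc & E).
    + intros; auto_derive; [auto|ring].
    + intros. apply continuity_pt_filterlim.
      apply (ex_derive_continuous (fun t => sin t - t * cos t)). auto_derive; auto.
    + rewrite Rmin_left, Rmax_right in Hc by lra.
      rewrite sin_0, Rmult_0_l, !Rminus_0_r in E.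
      assert (0 <= sin c) by (apply sin_ge_0; lra).
      assert (0 <= c * sin c) by (apply Rmult_le_pos; lra).
      nra.
Qed.

(** Pointwise, [1 - cos(2zt) = 2 sin^2(zt) <= 2 z^2 t^2], and two of the cosine factors absorb [t^2]
    through [t^2 cos^2 t <= sin^2 t = 1 - cos^2 t]. The bound is thus again made of cosine integrals
    at [z = 0]. *)
Lemma cosint_close z N :
  0 <= cosint 0 (2 * N + 2) - cosint z (2 * N + 2)
    <= 2 * z ^ 2 * (cosint 0 (2 * N) - cosint 0 (2 * N + 2)).
Proof.
  pose proof PI_RGT_0.
  pose proof (fun z n => RInt_correct (V := R_CompleteNormedModule) _ _ _ (ex_RInt_cosint z n)) as HI.
  pose proof (is_RInt_minus _ _ _ _ _ _ (HI 0 (2 * N + 2)%nat) (HI z (2 * N + 2)%nat)) as H1.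
  pose proof (is_RInt_scal _ _ _ (2 * z ^ 2) _
     (is_RInt_minus _ _ _ _ _ _ (HI 0 (2 * N)%nat) (HI 0 (2 * N + 2)%nat))) as H2.
  assert (Hpw : forall t, 0 < t < PI / 2 ->
    0 <= cos (2 * 0 * t) * cos t ^ (2 * N + 2) - cos (2 * z * t) * cos t ^ (2 * N + 2)
      <= 2 * z ^ 2 * (cos (2 * 0 * t) * cos t ^ (2 * N) - cos (2 * 0 * t) * cos t ^ (2 * N + 2))).
  { intros t Ht.
    rewrite Rmult_0_r, Rmult_0_l, cos_0.
    replace (2 * z * t) with (2 * (z * t)) by ring. rewrite cos_2a_sin.
    rewrite pow_add, pow_mult.
    pose proof (sin_sqr_le (z * t)) as Hs.
    pose proof (mul_cos_le_sin t ltac:(lra)) as Hc.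
    pose proof (sin2_cos2 t) as Hsc. unfold Rsqr in Hsc.
    assert (0 <= (cos t ^ 2) ^ N) by apply pow_le, pow2_ge_0.
    set (p := (cos t ^ 2) ^ N) in *.
    assert (0 <= sin (z * t) * sin (z * t) * cos t ^ 2 <= z ^ 2 * sin t ^ 2).
    { pose proof (pow2_ge_0 (cos t)). pose proof (pow2_ge_0 z). pose proof (pow2_ge_0 (sin (z*t))). split.
      - apply Rmult_le_pos; nra.
      - apply Rle_trans with ((z * t) ^ 2 * cos t ^ 2).
        + apply Rmult_le_compat_r; nra.
        + replace ((z * t) ^ 2 * cos t ^ 2) with (z ^ 2 * (t * cos t) ^ 2) by ring.
          apply Rmult_le_compat_l; [assumption|]. apply pow_incr; assumption. }
    replace (1 * (p * cos t ^ 2) - (1 - 2 * sin (z * t) * sin (z * t)) * (p * cos t ^ 2))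
      with (2 * p * (sin (z * t) * sin (z * t) * cos t ^ 2)) by ring.
    replace (2 * z ^ 2 * (1 * p - 1 * (p * cos t ^ 2)))
      with (2 * p * (z ^ 2 * sin t ^ 2)).
    2: { replace (sin t ^ 2) with (1 - cos t ^ 2) by (simpl; lra). ring. }
    split; [apply Rmult_le_pos; lra|apply Rmult_le_compat_l; lra]. }
  split.
  - apply (is_RInt_le (fun _ => 0) _ 0 (PI / 2) 0 _ ltac:(lra)) with (3 := fun t Ht => proj1 (Hpw t Ht)).
    + replace 0 with (scal (PI / 2 - 0) 0) at 2 by apply Rmult_0_r. apply (is_RInt_const (V := R_NormedModule)).
    + exact H1.
  - apply (is_RInt_le _ _ 0 (PI / 2) _ _ ltac:(lra) H1 H2 (fun t Ht => proj2 (Hpw t Ht))).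
Qed.

(** The recurrence at [z = 0] turns the difference in [cosint_close] into
    [cosint 0 (2N+2) / (2N+1)], so the ratio at [N + 1] lies between [1 - 2 z^2 / (2N+1)] and
    [1]. *)
Lemma cosint_ratio_lim z :
  is_lim_seq (fun N => cosint z (2 * N) / cosint 0 (2 * N)) 1.
Proof.
  apply is_lim_seq_incr_1.
  apply is_lim_seq_le_le with (u := fun N => 1 - 2 * z ^ 2 * / INR (2 * N + 1)) (w := fun _ => 1).
  - intros N. replace (2 * S N)%nat with (2 * N + 2)%nat by lia.
    pose proof (cosint_close z N) as [H1 H2].
    pose proof (cosint_rec 0 (2 * N)) as H.
    pose proof (cosint_0_even_pos (S N)) as Hp.
    replace (2 * S N)%nat with (2 * N + 2)%nat in Hp by lia.
    assert (P2 : 0 < INR (2 * N + 2)) by (apply lt_0_INR; lia).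
    assert (P1 : 0 < INR (2 * N + 1)) by (apply lt_0_INR; lia).
    assert (E2 : INR (2 * N + 2) = INR (2 * N + 1) + 1).
    { replace (2 * N + 2)%nat with (S (2 * N + 1)) by lia. apply S_INR. }
    assert (E : cosint 0 (2 * N) - cosint 0 (2 * N + 2) = cosint 0 (2 * N + 2) / INR (2 * N + 1)).
    { apply Rmult_eq_reg_l with (INR (2 * N + 2) * INR (2 * N + 1)); [|nra].
      rewrite Rmult_minus_distr_l, <- H. rewrite E2. field. lra. }
    rewrite E in H2. clear E H.
    split.
    + apply Rmult_le_reg_r with (cosint 0 (2 * N + 2)); [assumption|].
      field_simplify; [|lra|lra].
      apply Rmult_le_reg_r with (INR (2 * N + 1)); [assumption|].
      apply (Rmult_le_compat_r (INR (2 * N + 1))) in H2; [|lra].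
      field_simplify; [|lra]. field_simplify in H2; lra.
    + apply Rmult_le_reg_r with (cosint 0 (2 * N + 2)); [assumption|].
      field_simplify; lra.
  - replace (Finite 1) with (Finite (1 - 2 * z ^ 2 * 0)) by (f_equal; ring).
    apply is_lim_seq_minus'; [apply is_lim_seq_const|].
    apply (is_lim_seq_scal_l _ _ 0).
    apply (is_lim_seq_subseq (fun n => / INR n) 0 (fun N => (2 * N + 1)%nat)).
    + apply eventually_subseq. intros; lia.
    + replace (Finite 0) with (Rbar_inv p_infty) by reflexivity.
      apply is_lim_seq_inv; [apply is_lim_seq_INR|discriminate].
  - apply is_lim_seq_const.
Qed.

(** The Pochhammer quotient is the product of [1 - z^2 / m^2] over [1 <= m <= N]. There is no
    division by [cosint z 0], which vanishes at nonzero integers [z]. *)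
Lemma cosint_poch z N :
  poch (1 - z) N * poch (1 + z) N / INR (fact N) ^ 2 * cosint z (2 * N) * cosint 0 0
  = cosint 0 (2 * N) * cosint z 0.
Proof.
  induction N as [|N IH].
  - simpl. field.
  - replace (2 * S N)%nat with (2 * N + 2)%nat by lia.
    pose proof (cosint_rec 0 (2 * N)) as H0. pose proof (cosint_rec z (2 * N)) as Hz.
    simpl poch. rewrite fact_simpl, mult_INR, S_INR.
    pose proof (INR_fact_neq_0 N) as Hf.
    pose proof (pos_INR N) as HN.
    replace (INR (2 * N + 2)) with (2 * (INR N + 1)) in * by (rewrite plus_INR, mult_INR; simpl; ring).
    replace (INR (2 * N + 1)) with (2 * INR N + 1) in * by (rewrite plus_INR, mult_INR; simpl; ring).
    set (m := INR N) in *. set (q := INR (fact N)) in *.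
    assert (E0 : cosint 0 (2 * N + 2) = (2 * m + 1) / (2 * (m + 1)) * cosint 0 (2 * N)).
    { apply Rmult_eq_reg_l with ((2 * (m + 1)) ^ 2 - 4 * 0 ^ 2); [|nra].
      rewrite H0. field. lra. }
    (* The two factors stay on the left because [1 - z + m] or [1 + z + m] can be zero. *)
    assert (Ez : (1 - z + m) * (1 + z + m) * cosint z (2 * N + 2)
                 = (2 * m + 1) * (m + 1) / 2 * cosint z (2 * N)).
    { apply Rmult_eq_reg_l with 4; [|lra].
      transitivity (((2 * (m + 1)) ^ 2 - 4 * z ^ 2) * cosint z (2 * N + 2)); [ring|].
      rewrite Hz. field. }
    rewrite E0.
    transitivity ((2 * m + 1) / (2 * (m + 1)) * (cosint 0 (2 * N) * cosint z 0)); [|ring].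
    rewrite <- IH.
    transitivity (poch (1 - z) N * poch (1 + z) N / ((m + 1) * q) ^ 2
       * ((1 - z + m) * (1 + z + m) * cosint z (2 * N + 2)) * cosint 0 0).
    { field. lra. }
    rewrite Ez. field. lra.
Qed.

Lemma sin_product z : z <> 0 ->
  is_lim_seq (fun N => poch (1 - z) N * poch (1 + z) N / INR (fact N) ^ 2)
    (sin (PI * z) / (PI * z)).
Proof.
  intros Hz. pose proof PI_RGT_0 as Hpi.
  pose proof (cosint_ratio_lim z) as Hr.
  set (r := fun N => cosint z (2 * N) / cosint 0 (2 * N)) in Hr.
  apply is_lim_seq_ext_loc with (fun N => sin (PI * z) / (PI * z) / r N).
  (* Tolerance [1/2] around the limit [1] keeps the ratio away from [0], so it can eventually be
     divided by. *)
  - destruct (proj2 (is_lim_seq_spec _ _) Hr (mkposreal (1/2) ltac:(lra))) as [N0 HN0].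
    exists N0. intros N HN. specialize (HN0 N HN). simpl in HN0.
    apply Rabs_def2 in HN0.
    assert (Hr0 : r N <> 0) by lra.
    pose proof (cosint_poch z N) as H.
    pose proof (cosint_0_even_pos N) as Hp.
    rewrite cosint_0_eq, (cosint_eq z Hz) in H.
    set (P := poch (1 - z) N * poch (1 + z) N / INR (fact N) ^ 2) in *.
    apply Rmult_eq_reg_r with (r N * (PI / 2)); [|nra].
    transitivity (sin (PI * z) / (2 * z)); [field; repeat split; lra|].
    apply Rmult_eq_reg_l with (cosint 0 (2 * N)); [|lra].
    rewrite <- H. unfold r. field. lra.
  - replace (Finite (sin (PI * z) / (PI * z))) with (Finite (sin (PI * z) / (PI * z) / 1))
      by (f_equal; field; lra).
    apply is_lim_seq_div'; [apply is_lim_seq_const|exact Hr|lra].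
Qed.

(** * Exchange of summations under a product bound *)

Lemma sum_n_S (a : nat -> R) N : sum_n a (S N) = sum_n a N + a (S N).
Proof. apply (sum_Sn a N). Qed.

Lemma sum_n_le_series (a : nat -> R) l N :
  (forall n, 0 <= a n) -> is_series a l -> sum_n a N <= l.
Proof.
  intros Ha Hl. apply (is_lim_seq_incr_compare (sum_n a)); [exact Hl|].
  intros n. rewrite sum_n_S. specialize (Ha (S n)). lra.
Qed.

(** Both [b + a] and [b - a] have nonnegative terms, so their partial sums stay below their sums. *)
Lemma series_tail_le (a b : nat -> R) la lb N :
  (forall n, Rabs (a n) <= b n) -> is_series a la -> is_series b lb ->
  Rabs (la - sum_n a N) <= lb - sum_n b N.
Proof.
  intros Hab Ha Hb.
  assert (H1 : is_series (fun n => b n + a n) (lb + la)) by exact (is_series_plus _ _ _ _ Hb Ha).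
  assert (H2 : is_series (fun n => b n - a n) (lb - la)) by exact (is_series_minus _ _ _ _ Hb Ha).
  apply (sum_n_le_series _ _ N) in H1, H2;
    try (intros n; specialize (Hab n); apply Rabs_le_between in Hab; lra).
  assert (E1 : forall M, sum_n (fun n => b n + a n) M = sum_n b M + sum_n a M).
  { induction M; rewrite ?sum_O, ?sum_n_S; [reflexivity|lra]. }
  assert (E2 : forall M, sum_n (fun n => b n - a n) M = sum_n b M - sum_n a M).
  { induction M; rewrite ?sum_O, ?sum_n_S; [reflexivity|lra]. }
  rewrite E1 in H1. rewrite E2 in H2. apply Rabs_le_between. lra.
Qed.

Lemma sum_antidiagonal (c : nat -> nat -> R) N :
  sum_n (fun i => sum_n (fun j => c j (i - j)%nat) i) N =
  sum_n (fun j => sum_n (c j) (N - j)) N.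
Proof.
  induction N as [|N IH].
  - rewrite !sum_O. simpl. rewrite ?sum_O. reflexivity.
  - rewrite sum_n_S, IH. rewrite (sum_n_S (fun j => sum_n (c j) (S N - j)) N).
    rewrite (sum_n_S (fun j => c j (S N - j)%nat) N).
    rewrite Nat.sub_diag, sum_O, <- Rplus_assoc. f_equal.
    etransitivity; [symmetry; apply (sum_n_plus (G := R_AbelianMonoid))|].
    apply sum_n_ext_loc. intros j Hj.
    replace (S N - j)%nat with (S (N - j)) by lia. rewrite sum_n_S. reflexivity.
Qed.

(** The triangular partial sums of [c] differ from the partial sums of [s] by no more than the same
    gap for [p j * q m], and that gap tends to [0] because the Cauchy product of [p] and [q]
    converges to the product of their sums. *)
Lemma is_series_antidiagonal (c : nat -> nat -> R) (p q s : nat -> R) :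
  (forall j, 0 <= p j) -> (forall m, 0 <= q m) ->
  (forall j m, Rabs (c j m) <= p j * q m) ->
  ex_series p -> ex_series q ->
  (forall j, is_series (c j) (s j)) ->
  is_series (fun N => sum_n (fun j => c j (N - j)%nat) N) (Series s).
Proof.
  intros Hp Hq Hc [P HP] [Q HQ] Hs.
  assert (Hpq : forall j, is_series (fun m => p j * q m) (p j * Q)).
  { intros j. apply (is_series_scal_l (p j) q Q HQ). }
  assert (Hex : ex_series s).
  { apply (ex_series_le (V := R_CompleteNormedModule)) with (fun j => p j * Q).
    - intros j.
      pose proof (series_tail_le _ _ _ _ 0 (Hc j) (Hs j) (Hpq j)) as H.
      rewrite !sum_O in H. specialize (Hc j 0%nat).
      change (Rabs (s j) <= p j * Q).
      replace (s j) with (s j - c j 0%nat + c j 0%nat) by ring.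
      eapply Rle_trans; [apply Rabs_triang|]. lra.
    - exists (P * Q). apply (is_series_scal_r Q p P HP). }
  pose proof (Series_correct _ Hex) as HS.
  pose proof (is_series_mult_pos _ _ _ _ HP HQ Hp Hq) as HM.
  assert (Hgap : is_lim_seq (fun N => sum_n s N - sum_n (fun i => sum_n (fun j => c j (i - j)%nat) i) N) 0).
  { apply is_lim_seq_abs_0.
    apply is_lim_seq_le_le with (u := fun _ => 0)
      (w := fun N => sum_n p N * Q - sum_n (fun i => sum_f_R0 (fun k => p k * q (i - k)%nat) i) N).
    - (* The gap is at most what the [p j * q m] sum to outside the triangle. *)
      intros N. split; [apply Rabs_pos|].
      rewrite sum_antidiagonal.
      replace (sum_n (fun i => sum_f_R0 (fun k => p k * q (i - k)%nat) i) N)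
        with (sum_n (fun j => sum_n (fun m => p j * q m) (N - j)) N).
      2: { rewrite <- (sum_antidiagonal (fun j m => p j * q m)).
           apply sum_n_ext. intros i. apply sum_n_Reals. }
      (* The column lengths [f] are decoupled from the number of columns [K], since [N - j] would
         change along an induction on [N]. *)
      assert (Hgen : forall f K,
        Rabs (sum_n s K - sum_n (fun j => sum_n (c j) (f j)) K)
         <= sum_n p K * Q - sum_n (fun j => sum_n (fun m => p j * q m) (f j)) K).
      { intros f K. induction K as [|K IH].
        - rewrite !sum_O. apply series_tail_le; auto.
        - rewrite !sum_n_S.
          pose proof (series_tail_le _ _ _ _ (f (S K)) (Hc (S K)) (Hs (S K)) (Hpq (S K))) as H.
          apply Rabs_le_between in H. apply Rabs_le_between in IH.
          apply Rabs_le_between. lra. }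
      apply (Hgen (fun j => (N - j)%nat) N).
    - apply is_lim_seq_const.
    - replace (Finite 0) with (Finite (P * Q - P * Q)) by (f_equal; ring).
      apply is_lim_seq_minus'; [|exact HM].
      apply (is_lim_seq_scal_r _ Q P). exact HP. }
  change (is_lim_seq (sum_n (fun N => sum_n (fun j => c j (N - j)%nat) N)) (Series s)).
  apply is_lim_seq_ext with (fun N => sum_n s N -
     (sum_n s N - sum_n (fun i => sum_n (fun j => c j (i - j)%nat) i) N)).
  - intros; ring.
  - replace (Finite (Series s)) with (Finite (Series s - 0)) by (f_equal; ring).
    apply is_lim_seq_minus'; [exact HS|exact Hgap].
Qed.

(** * Weights, Gosper telescoping and Gauss sums at 1 *)

Lemma poch_S_l c m : poch c (S m) = c * poch (c + 1) m.
Proof.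
  induction m as [|m IH]; [simpl; ring|].
  change (poch c (S m) * (c + INR (S m)) = c * (poch (c + 1) m * (c + 1 + INR m))).
  rewrite IH, S_INR. ring.
Qed.

Lemma poch_1 m : poch 1 m = INR (fact m).
Proof.
  induction m as [|m IH]; [reflexivity|].
  rewrite fact_simpl, mult_INR, S_INR. simpl. rewrite IH. ring.
Qed.

Lemma poch_pos c m : 0 < c -> 0 < poch c m.
Proof.
  intros Hc. induction m as [|m IH]; simpl; [lra|].
  apply Rmult_lt_0_compat; [assumption|]. pose proof (pos_INR m); lra.
Qed.

Lemma falling_poch a m : falling a m = (-1) ^ m * poch (- a) m.
Proof. induction m as [|m IH]; simpl; [ring|]. rewrite IH. ring. Qed.

Lemma INR_fact_S m : INR (fact (S m)) = (INR m + 1) * INR (fact m).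
Proof. rewrite fact_simpl, mult_INR, S_INR. ring. Qed.

Lemma fact_mul_le i j : (fact i * fact j <= fact (i + j))%nat.
Proof.
  induction j as [|j IH]; [rewrite Nat.add_0_r; simpl; lia|].
  rewrite Nat.add_succ_r, !fact_simpl. nia.
Qed.

Definition hgw (b : R) (m : nat) : R := poch (- b) m * poch (b + 1) m / INR (fact m).

(** The new factors multiply to [(m - b)(m + b + 1) = m(m + 1) - b(b + 1)], the same quadratic that
    multiplies the sums in the telescoping identities. *)
Lemma hgw_S b m :
  hgw b (S m) * (INR m + 1) = hgw b m * (INR m * (INR m + 1) - b * (b + 1)).
Proof.
  unfold hgw. rewrite INR_fact_S. simpl.
  pose proof (INR_fact_neq_0 m). pose proof (pos_INR m). field. lra.
Qed.

Lemma gbinom_poch b m :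
  gbinom b m * poch (b + 1) m = (-1) ^ m * hgw b m.
Proof.
  unfold gbinom, hgw. rewrite falling_poch. field. apply INR_fact_neq_0.
Qed.

(** With [T_m = m w_m / (m+j)!] each summand on the left is [T_(m+1) - T_m]: by [hgw_S] this rests
    on [m(m+1) - m(m+j+1) = j(j+1) - j(m+j+1)]. Being an identity of partial sums, it serves both
    infinite and terminating sums. *)
Lemma gauss_telescope b j N :
  (INR j * (INR j + 1) - b * (b + 1)) * sum_n (fun m => hgw b m / INR (fact (m + S j))) N
   - INR j * sum_n (fun m => hgw b m / INR (fact (m + j))) N
  = (INR N + 1) * hgw b (S N) / INR (fact (S N + j)).
Proof.
  induction N as [|N IH].
  - rewrite !sum_O. rewrite !Nat.add_0_l. change (1 + j)%nat with (S j). rewrite INR_fact_S.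
    pose proof (hgw_S b 0) as H. change (INR 0) with 0 in *.
    pose proof (INR_fact_neq_0 j). pose proof (pos_INR j).
    replace (hgw b 1) with (hgw b 0 * (- (b * (b + 1)))) by lra. field. lra.
  - rewrite !sum_n_S.
    replace (S N + S j)%nat with (S (S N + j)) by lia.
    replace (S (S N) + j)%nat with (S (S N + j)) by lia.
    pose proof (hgw_S b (S N)) as H.
    rewrite (Rmult_comm (INR (S N) + 1)), H.
    pose proof (INR_fact_neq_0 (S N + j)).
    rewrite (INR_fact_S (S N + j)), plus_INR, S_INR.
    pose proof (pos_INR j). pose proof (pos_INR N).
    set (F := INR (fact (S N + j))) in *.
    set (A1 := sum_n (fun m => hgw b m / INR (fact (m + S j))) N : R) in *.
    set (A2 := sum_n (fun m => hgw b m / INR (fact (m + j))) N : R) in *.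
    transitivity ((INR j * (INR j + 1) - b * (b + 1)) * A1 - INR j * A2 +
      ((INR j * (INR j + 1) - b * (b + 1)) * (hgw b (S N) / ((INR N + 1 + INR j + 1) * F)) - INR j * (hgw b (S N) / F))); [ring|].
    rewrite IH. field. lra.
Qed.

(** Splitting off the first factor of [(-b)_(N+1)] and the last of [(b+1)_(N+1)] leaves the partial
    sine product times [-b (1 + b / (N+1))]. *)
Lemma hgw_lim b : b <> 0 ->
  is_lim_seq (fun N => hgw b (S N) / INR (fact N)) (- (sin (PI * b) / PI)).
Proof.
  intros Hb. pose proof PI_RGT_0.
  apply is_lim_seq_ext with (fun N =>
    - b * (poch (1 - b) N * poch (1 + b) N / INR (fact N) ^ 2) * (1 + b * / INR (S N))).
  - intros N. unfold hgw. rewrite (poch_S_l (- b)).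
    change (poch (b + 1) (S N)) with (poch (b + 1) N * (b + 1 + INR N)).
    rewrite INR_fact_S, S_INR.
    replace (- b + 1) with (1 - b) by ring. rewrite (Rplus_comm 1 b).
    pose proof (INR_fact_neq_0 N). pose proof (pos_INR N). field. lra.
  - replace (Finite (- (sin (PI * b) / PI)))
      with (Finite (- b * (sin (PI * b) / (PI * b)) * (1 + b * 0))) by (f_equal; field; lra).
    apply is_lim_seq_mult'.
    + apply (is_lim_seq_scal_l _ (- b) (sin (PI * b) / (PI * b))). apply sin_product, Hb.
    + apply is_lim_seq_plus'; [apply is_lim_seq_const|].
      apply (is_lim_seq_scal_l _ b 0).
      apply (is_lim_seq_incr_1 (fun n => / INR n)).
      replace (Finite 0) with (Rbar_inv p_infty) by reflexivity.
      apply is_lim_seq_inv; [apply is_lim_seq_INR|discriminate].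
Qed.

Lemma ex_series_inv_pronic : ex_series (fun m => / ((INR m + 1) * (INR m + 2))).
Proof.
  exists 1.
  change (is_lim_seq (sum_n (fun m => / ((INR m + 1) * (INR m + 2)))) 1).
  apply is_lim_seq_ext with (fun N => 1 - / INR (N + 2)).
  - intros N. rewrite plus_INR; simpl (INR 2).
    induction N as [|N IH].
    + rewrite sum_O. simpl. field.
    + rewrite sum_n_S, <- IH, S_INR. pose proof (pos_INR N). field. lra.
  - replace (Finite 1) with (Finite (1 - 0)) by (f_equal; ring).
    apply is_lim_seq_minus'; [apply is_lim_seq_const|].
    apply (is_lim_seq_incr_n (fun n => / INR n)).
    replace (Finite 0) with (Rbar_inv p_infty) by reflexivity.
    apply is_lim_seq_inv; [apply is_lim_seq_INR|discriminate].
Qed.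

Lemma hgw_bound b : b <> 0 ->
  exists C, 0 <= C /\ forall m, Rabs (hgw b m) / INR (fact (S m)) <= C * / ((INR m + 1) * (INR m + 2)).
Proof.
  intros Hb. pose proof (hgw_lim b Hb) as Hl.
  destruct (filterlim_bounded (V := R_NormedModule) _ (ex_intro _ (- (sin (PI * b) / PI)) Hl))
    as [M HM].
  assert (HM' : forall N, Rabs (hgw b (S N)) <= M * INR (fact N)).
  { intros N. specialize (HM N). change (Rabs (hgw b (S N) / INR (fact N)) <= M) in HM.
    pose proof (INR_fact_lt_0 N).
    unfold Rdiv in HM. rewrite Rabs_mult, (Rabs_right (/ _)) in HM
      by (apply Rle_ge, Rlt_le, Rinv_0_lt_compat; assumption).
    apply Rmult_le_reg_r with (/ INR (fact N)); [apply Rinv_0_lt_compat; assumption|].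
    rewrite Rmult_assoc, Rinv_r, Rmult_1_r; lra. }
  assert (0 <= M) by (exact (Rle_trans _ _ _ (Rabs_pos _) (HM 0%nat))).
  (* For [m = N + 1] the bound [M / ((N+1)(N+2))] loses a factor [(N+3)/(N+1) <= 3]; the summand [2]
     covers [m = 0]. *)
  exists (3 * M + 2). split; [lra|].
  intros [|N].
  - unfold hgw. simpl. replace (1 * 1 / 1) with 1 by field. rewrite Rabs_R1.
    replace (1 / 1) with 1 by field. replace (/ ((0 + 1) * (0 + 2))) with (1/2) by field. lra.
  - specialize (HM' N). pose proof (INR_fact_lt_0 N) as HF. pose proof (pos_INR N).
    rewrite !INR_fact_S, S_INR.
    apply Rle_trans with (M * INR (fact N) / ((INR N + 1 + 1) * ((INR N + 1) * INR (fact N)))).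
    + apply Rmult_le_compat_r; [|assumption].
      apply Rlt_le, Rinv_0_lt_compat. repeat apply Rmult_lt_0_compat; lra.
    + apply Rminus_le.
      replace (M * INR (fact N) / ((INR N + 1 + 1) * ((INR N + 1) * INR (fact N)))
         - (3 * M + 2) * / ((INR N + 1 + 1) * (INR N + 1 + 2)))
      with (- ((2 * M * INR N + 2 * (INR N + 1)) * / ((INR N + 1) * ((INR N + 2) * (INR N + 3)))))
        by (field; lra).
      assert (0 < / ((INR N + 1) * ((INR N + 2) * (INR N + 3))))
        by (apply Rinv_0_lt_compat; repeat apply Rmult_lt_0_compat; lra).
      assert (0 <= 2 * M * INR N + 2 * (INR N + 1)) by nra.
      nra.
Qed.

(** Separates the two indices, as the domination by [p_j q_m] requires. *)
Lemma inv_fact_le m j : / INR (fact (m + S j)) <= / INR (fact (S m)) * / INR (fact j).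
Proof.
  rewrite <- Rinv_mult, <- mult_INR.
  apply Rinv_le_contravar.
  - apply lt_0_INR. apply Nat.mul_pos_pos; apply lt_O_fact.
  - apply le_INR. replace (m + S j)%nat with (S m + j)%nat by lia. apply fact_mul_le.
Qed.

Lemma hgw_term_bound b C m j :
  Rabs (hgw b m) / INR (fact (S m)) <= C * / ((INR m + 1) * (INR m + 2)) ->
  Rabs (hgw b m / INR (fact (m + S j)))
    <= / INR (fact j) * (C * / ((INR m + 1) * (INR m + 2))).
Proof.
  intros H.
  pose proof (INR_fact_lt_0 (m + S j)) as HF.
  pose proof (Rinv_0_lt_compat _ (INR_fact_lt_0 j)) as HJ.
  unfold Rdiv. rewrite Rabs_mult, (Rabs_right (/ _))
    by (apply Rle_ge, Rlt_le, Rinv_0_lt_compat; assumption).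
  apply Rle_trans with (Rabs (hgw b m) * (/ INR (fact (S m)) * / INR (fact j))).
  - apply Rmult_le_compat_l; [apply Rabs_pos|apply inv_fact_le].
  - rewrite <- Rmult_assoc, Rmult_comm. apply Rmult_le_compat_l; [lra|exact H].
Qed.

(* For [j >= 1] this is 2F1(-b, b+1; j+1; 1) / j!; for [j = 0] the terms only decay like 1/m. *)
Definition gauss_sum (b : R) (j : nat) : R :=
  Series (fun m => hgw b m / INR (fact (m + j))).

Lemma gauss_sum_correct b j : b <> 0 ->
  is_series (fun m => hgw b m / INR (fact (m + S j))) (gauss_sum b (S j)).
Proof.
  intros Hb. apply Series_correct.
  destruct (hgw_bound b Hb) as (C & HC & H).
  apply (ex_series_le (V := R_CompleteNormedModule)) with
    (fun m => / INR (fact j) * (C * / ((INR m + 1) * (INR m + 2)))).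
  - intros m. apply hgw_term_bound, H.
  - apply (ex_series_scal (V := R_NormedModule) (/ INR (fact j))).
    apply (ex_series_scal (V := R_NormedModule) C). apply ex_series_inv_pronic.
Qed.

(** At [j = 0] the second sum of [gauss_telescope] has coefficient [0], and the boundary term is the
    sequence of [hgw_lim]. *)
Lemma gauss_sum_1 b : b <> 0 -> b * (b + 1) * gauss_sum b 1 = sin (PI * b) / PI.
Proof.
  intros Hb.
  assert (H : is_lim_seq (fun N => hgw b (S N) / INR (fact N)) (- (b * (b + 1)) * gauss_sum b 1)).
  { apply is_lim_seq_ext with (fun N => - (b * (b + 1)) * sum_n (fun m => hgw b m / INR (fact (m + 1))) N).
    - intros N. pose proof (gauss_telescope b 0 N) as H. simpl (INR 0) in H.
      rewrite !Rmult_0_l, Rminus_0_r, Rminus_0_l, Nat.add_0_r, INR_fact_S in H.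
      rewrite H. pose proof (INR_fact_neq_0 N). pose proof (pos_INR N). field. lra.
    - apply (is_lim_seq_scal_l _ (- (b * (b + 1))) (gauss_sum b 1)).
      apply (gauss_sum_correct b 0 Hb). }
  apply is_lim_seq_unique in H.
  rewrite (is_lim_seq_unique _ _ (hgw_lim b Hb)) in H. injection H as H. lra.
Qed.

(** For positive index the boundary term of the telescoping is smaller than the one in [gauss_sum_1]
    by a factor of at most [1 / (N+2)], hence tends to [0]. *)
Lemma gauss_sum_S b j : b <> 0 ->
  (INR (S j) * (INR (S j) + 1) - b * (b + 1)) * gauss_sum b (S (S j))
  = INR (S j) * gauss_sum b (S j).
Proof.
  intros Hb.
  set (k := INR (S j)).
  assert (H1 : is_lim_seq (fun N => (INR N + 1) * hgw b (S N) / INR (fact (S N + S j)))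
     ((k * (k + 1) - b * (b + 1)) * gauss_sum b (S (S j)) - k * gauss_sum b (S j))).
  { eapply is_lim_seq_ext; [intros N; apply gauss_telescope|].
    apply is_lim_seq_minus'.
    - apply (is_lim_seq_scal_l _ _ (gauss_sum b (S (S j)))). apply (gauss_sum_correct b (S j) Hb).
    - apply (is_lim_seq_scal_l _ _ (gauss_sum b (S j))). apply (gauss_sum_correct b j Hb). }
  assert (H0 : is_lim_seq (fun N => (INR N + 1) * hgw b (S N) / INR (fact (S N + S j))) 0).
  { apply is_lim_seq_abs_0.
    apply is_lim_seq_le_le with (u := fun _ => 0)
      (w := fun N => Rabs (hgw b (S N) / INR (fact N)) * / INR (N + 2)).
    - intros N. split; [apply Rabs_pos|].
      pose proof (INR_fact_lt_0 N) as HN. pose proof (pos_INR N).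
      replace ((INR N + 1) * hgw b (S N) / INR (fact (S N + S j)))
        with (hgw b (S N) / INR (fact N) * (((INR N + 1) * INR (fact N)) * / INR (fact (S N + S j))))
        by (field; split; [apply INR_fact_neq_0|lra]).
      rewrite Rabs_mult. apply Rmult_le_compat_l; [apply Rabs_pos|].
      rewrite <- INR_fact_S.
      pose proof (inv_fact_le (S N) j) as HI.
      pose proof (INR_fact_lt_0 (S N)) as HS.
      pose proof (Rinv_0_lt_compat _ (INR_fact_lt_0 (S N + S j))).
      rewrite Rabs_right by (apply Rle_ge, Rmult_le_pos; lra).
      replace (/ INR (N + 2)) with (INR (fact (S N)) * / INR (fact (S (S N)))).
      2: { rewrite (INR_fact_S (S N)), plus_INR, S_INR. simpl (INR 2). field. lra. }
      apply Rmult_le_compat_l; [lra|].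
      eapply Rle_trans; [exact HI|].
      pose proof (Rinv_0_lt_compat _ (INR_fact_lt_0 (S (S N)))).
      assert (/ INR (fact j) <= 1).
      { rewrite <- Rinv_1. apply Rinv_le_contravar; [lra|].
        apply (le_INR 1). apply lt_O_fact. }
      nra.
    - apply is_lim_seq_const.
    - replace (Finite 0) with (Finite (Rabs (- (sin (PI * b) / PI)) * 0)) by (f_equal; ring).
      apply is_lim_seq_mult'.
      + apply (is_lim_seq_abs _ (- (sin (PI * b) / PI))), hgw_lim, Hb.
      + apply (is_lim_seq_incr_n (fun n => / INR n)).
        replace (Finite 0) with (Rbar_inv p_infty) by reflexivity.
        apply is_lim_seq_inv; [apply is_lim_seq_INR|discriminate]. }
  apply is_lim_seq_unique in H1, H0. rewrite H1 in H0. injection H0 as H0. lra.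
Qed.

(** * The first identity *)

Lemma gbinom_S a m : gbinom a (S m) * (INR m + 1) = gbinom a m * (a - INR m).
Proof.
  unfold gbinom. rewrite INR_fact_S. simpl.
  pose proof (INR_fact_neq_0 m). pose proof (pos_INR m). field. lra.
Qed.

(** The coefficient in [gauss_sum_S] factors as [(j+1-b)(j+2+b)]. The binomial supplies the first
    factor up to sign and the Pochhammer symbol the second, so nothing is divided by [j+1-b] and
    integer [b] is included. *)
Lemma gbinom_gauss_sum b j : b <> 0 ->
  gbinom (b - 1) j * gauss_sum b (S j) * poch b (j + 2) = (-1) ^ j * (sin (PI * b) / PI).
Proof.
  intros Hb. induction j as [|j IH].
  - rewrite <- gauss_sum_1 by exact Hb. unfold gbinom. simpl. field.
  - pose proof (gauss_sum_S b j Hb) as HG. pose proof (gbinom_S (b - 1) j) as HB.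
    replace (S j + 2)%nat with (S (j + 2)) by lia.
    change (poch b (S (j + 2))) with (poch b (j + 2) * (b + INR (j + 2))).
    rewrite plus_INR; simpl (INR 2).
    rewrite S_INR in HG. pose proof (pos_INR j).
    apply Rmult_eq_reg_r with (INR j + 1); [|lra].
    transitivity (gbinom (b - 1) (S j) * (INR j + 1) * gauss_sum b (S (S j)) * (b + (INR j + 2)) * poch b (j + 2)); [ring|].
    rewrite HB.
    transitivity (- gbinom (b - 1) j * (((INR j + 1) * (INR j + 1 + 1) - b * (b + 1)) * gauss_sum b (S (S j))) * poch b (j + 2)); [ring|].
    rewrite HG. simpl pow.
    transitivity (- (INR j + 1) * (gbinom (b - 1) j * gauss_sum b (S j) * poch b (j + 2))); [ring|].
    rewrite IH. ring.
Qed.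

(** Each factor [(a - m)/(m + 1)] is at most [|a| + 1] in absolute value. Geometric growth suffices,
    as [1/j!] turns it into an exponential series. *)
Lemma gbinom_bound a m : Rabs (gbinom a m) <= (Rabs a + 1) ^ m.
Proof.
  induction m as [|m IH].
  - unfold gbinom. simpl. replace (1 / 1) with 1 by field. rewrite Rabs_R1. lra.
  - pose proof (gbinom_S a m) as H. pose proof (pos_INR m). pose proof (Rabs_pos a).
    apply (f_equal Rabs) in H. rewrite !Rabs_mult, (Rabs_right (INR m + 1)) in H by lra.
    apply Rmult_le_reg_r with (INR m + 1); [lra|]. rewrite H. simpl.
    pose proof (Rabs_triang a (- INR m)) as T. rewrite Rabs_Ropp, (Rabs_right (INR m)) in T by lra.
    change (a + - INR m) with (a - INR m) in T.
    rewrite Rmult_assoc, (Rmult_comm (Rabs a + 1)), !Rmult_assoc.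
    apply Rmult_le_compat; try apply Rabs_pos; [assumption|]. nra.
Qed.

Lemma sum_n_Rext (f g : nat -> R) N :
  (forall j, (j <= N)%nat -> f j = g j) -> sum_n f N = sum_n g N :> R.
Proof. apply (sum_n_ext_loc (G := R_AbelianMonoid)). Qed.

Lemma sum_n_Rmult_l (c : R) (f : nat -> R) N : sum_n (fun j => c * f j) N = c * sum_n f N.
Proof. apply (sum_n_mult_l (K := R_AbsRing)). Qed.

Lemma acoef_S al N x :
  acoef al (S N) x =
  sum_n (fun j => - (gbinom (al + 1) j * x ^ S j) *
     (hgw (al + 2) (N - j) / INR (fact (S N)))) N.
Proof.
  unfold acoef. rewrite <- sum_n_m_S.
  etransitivity; [symmetry; apply sum_n_Rmult_l|].
  apply sum_n_Rext. intros j Hj.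
  replace (S j - 1)%nat with j by lia. replace (S N - S j)%nat with (N - j)%nat by lia.
  pose proof (gbinom_poch (al + 2) (N - j)) as H.
  replace (al + 2 + 1) with (al + 3) in H by ring.
  (* Only the parity of [N - j + 1] counts; with the sign [(-1)^(N-j)] from [gbinom_poch] it leaves
     a constant [-1]. *)
  replace (S N + S j + 1)%nat with (S (N - j) + 2 * S j)%nat by lia.
  rewrite pow_add, pow_1_even.
  pose proof (INR_fact_neq_0 (S N)).
  transitivity (/ INR (fact (S N)) * ((-1) ^ S (N - j) * 1 * gbinom (al + 1) j
     * (gbinom (al + 2) (N - j) * poch (al + 3) (N - j)) * x ^ S j)); [ring|].
  rewrite H.
  assert (E : (-1) ^ S (N - j) * (-1) ^ (N - j) = -1).
  { simpl. rewrite Rmult_assoc, <- pow_add.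
    replace (N - j + (N - j))%nat with (2 * (N - j))%nat by lia. rewrite pow_1_even. ring. }
  transitivity (/ INR (fact (S N)) * (((-1) ^ S (N - j) * (-1) ^ (N - j)) * gbinom (al + 1) j
     * hgw (al + 2) (N - j) * x ^ S j)); [ring|].
  rewrite E. unfold Rdiv. ring.
Qed.

Lemma acoef_series al x : -1 < al ->
  is_series (fun n => acoef al (S n) x)
    (- (sin (PI * al) / PI) * (x / ((al + 2) * (al + 3))) * hyp1F1 1 (al + 4) (- x)).
Proof.
  intros Hal.
  set (b := al + 2).
  assert (Hb : b <> 0) by (unfold b; lra).
  destruct (hgw_bound b Hb) as (C & HC & HCb).
  set (K := Rabs (al + 1) + 1).
  set (u := fun j => - (gbinom (al + 1) j * x ^ S j)).
  (* Here [j] is one less than the power of [x], so [j + m = N] corresponds to [a_(N+1)]. *)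
  pose proof (is_series_antidiagonal
    (fun j m => u j * (hgw b m / INR (fact (m + S j))))
    (fun j => Rabs x * (/ INR (fact j) * (K * Rabs x) ^ j))
    (fun m => C * / ((INR m + 1) * (INR m + 2)))
    (fun j => u j * gauss_sum b (S j))) as H.
  assert (HK : 0 <= K * Rabs x).
  { unfold K. apply Rmult_le_pos; [|apply Rabs_pos]. pose proof (Rabs_pos (al + 1)); lra. }
  assert (Hq : forall m, 0 < / ((INR m + 1) * (INR m + 2))).
  { intros m. pose proof (pos_INR m). apply Rinv_0_lt_compat. apply Rmult_lt_0_compat; lra. }
  eapply is_series_ext; [|replace (_ * _ * _) with (Series (fun j => u j * gauss_sum b (S j)));
    [apply H; clear H|]].
  - intros N. cbv beta. rewrite acoef_S. apply sum_n_Rext. intros j Hj.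
    replace (N - j + S j)%nat with (S N) by lia. reflexivity.
  - intros j. apply Rmult_le_pos; [apply Rabs_pos|].
    apply Rmult_le_pos; [apply Rlt_le, Rinv_0_lt_compat, INR_fact_lt_0|apply pow_le, HK].
  - intros m. specialize (Hq m). nra.
  - intros j m. rewrite Rabs_mult.
    pose proof (hgw_term_bound b C m j (HCb m)) as H.
    assert (Hu : Rabs (u j) <= Rabs x * (K * Rabs x) ^ j).
    { unfold u. rewrite Rabs_Ropp, Rabs_mult, <- RPow_abs, Rpow_mult_distr. simpl.
      pose proof (gbinom_bound (al + 1) j) as HG. fold K in HG.
      transitivity (K ^ j * (Rabs x * Rabs x ^ j)); [|right; ring].
      apply Rmult_le_compat_r; [|exact HG].
      apply Rmult_le_pos; [|apply pow_le]; apply Rabs_pos. }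
    transitivity (Rabs x * (K * Rabs x) ^ j * (/ INR (fact j) * (C * / ((INR m + 1) * (INR m + 2)))));
      [|right; ring].
    apply Rmult_le_compat; try apply Rabs_pos; assumption.
  - apply (ex_series_scal (V := R_NormedModule) (Rabs x)).
    exists (exp (K * Rabs x)).
    apply (is_pseries_R (fun n => / INR (fact n))), is_exp_Reals.
  - apply (ex_series_scal (V := R_NormedModule) C), ex_series_inv_pronic.
  - intros j. apply (is_series_scal_l (u j) _ (gauss_sum b (S j))). apply gauss_sum_correct, Hb.
  - unfold hyp1F1. rewrite <- Series_scal_l. apply Series_ext. intros j.
    pose proof (gbinom_gauss_sum b j Hb) as HG.
    replace (b - 1) with (al + 1) in HG by (unfold b; ring).
    replace (sin (PI * b)) with (sin (PI * al)) in HG.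
    2: { unfold b. replace (PI * (al + 2)) with (PI * al + 2 * INR 1 * PI) by (simpl; ring).
         symmetry; apply sin_period. }
    replace (j + 2)%nat with (S (S j)) in HG by lia.
    (* [(b)_(j+2)] splits into [(al+2)(al+3)(al+4)_j], and [(1)_j] cancels the [j!] of the confluent
       series. *)
    rewrite !poch_S_l in HG. rewrite poch_1.
    replace (b + 1 + 1) with (al + 4) in HG by (unfold b; ring).
    pose proof (poch_pos (al + 4) j ltac:(lra)). pose proof (INR_fact_neq_0 j).
    pose proof PI_RGT_0.
    assert (HG' : gbinom (al + 1) j * gauss_sum b (S j)
       = (-1) ^ j * (sin (PI * al) / PI) / ((al + 2) * ((al + 3) * poch (al + 4) j))).
    { rewrite <- HG. unfold b. field. lra. }
    unfold u.
    transitivity (- x ^ S j * (gbinom (al + 1) j * gauss_sum b (S j))); [ring|].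
    rewrite HG'. replace (- x) with (-1 * x) by ring. rewrite Rpow_mult_distr. simpl.
    unfold b. field. lra.
Qed.

(** * Terminating sums for integer parameter *)

(* Reciprocal factorial of [s - k], extended by [0] to negative arguments: with this convention
   telescoping needs no boundary terms. *)
Definition rfact (s k : nat) : R := if k <=? s then / INR (fact (s - k)) else 0.

Lemma rfact_S s k : rfact s (S k) = (INR s - INR k) * rfact s k.
Proof.
  unfold rfact. destruct (Nat.leb_spec (S k) s), (Nat.leb_spec k s); try lia.
  - replace (s - k)%nat with (S (s - S k)) by lia.
    rewrite INR_fact_S. rewrite minus_INR, S_INR by lia.
    pose proof (INR_fact_neq_0 (s - S k)). apply le_INR in H. rewrite S_INR in H.
    field. split; [assumption|lra].
  - replace s with k by lia. ring.
  - ring.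
Qed.

Lemma rfact_SS s k : rfact (S s) (S k) = rfact s k.
Proof. reflexivity. Qed.

Lemma rfact_add m q : rfact (m + q) q = / INR (fact m).
Proof.
  unfold rfact. destruct (Nat.leb_spec q (m + q)); [|lia].
  replace (m + q - q)%nat with m by lia. reflexivity.
Qed.

(** This is [gauss_telescope] read at [j = -q - 1], for which [j(j+1) = q(q+1)]. *)
Lemma rfact_telescope b q N :
  (INR q * (INR q + 1) - b * (b + 1)) * sum_n (fun m => hgw b m * rfact m q) N
   + (INR q + 1) * sum_n (fun m => hgw b m * rfact m (S q)) N
  = (INR N + 1) * hgw b (S N) * rfact N q.
Proof.
  induction N as [|N IH].
  - rewrite !sum_O. rewrite rfact_S. pose proof (hgw_S b 0) as H. change (INR 0) with 0 in *.
    replace (hgw b 1) with (hgw b 0 * (- (b * (b + 1)))) by lra. ring.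
  - rewrite !sum_n_S.
    pose proof (hgw_S b N) as H1. pose proof (hgw_S b (S N)) as H2.
    rewrite <- (rfact_SS N q) in IH. rewrite rfact_S in IH.
    rewrite (Rmult_comm (INR (S N) + 1)), H2. rewrite (rfact_S (S N) q).
    rewrite S_INR in *.
    set (A1 := sum_n (fun m => hgw b m * rfact m q) N : R) in *.
    set (A2 := sum_n (fun m => hgw b m * rfact m (S q)) N : R) in *.
    transitivity ((INR q * (INR q + 1) - b * (b + 1)) * A1 + (INR q + 1) * A2
      + ((INR q * (INR q + 1) - b * (b + 1)) + (INR q + 1) * (INR N + 1 - INR q)) * (hgw b (S N) * rfact (S N) q)); [ring|].
    rewrite IH. ring.
Qed.

Lemma poch_opp_INR_0 B m : (B < m)%nat -> poch (- INR B) m = 0.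
Proof.
  intros H. induction H as [|m H IH]; simpl.
  - ring.
  - rewrite IH; ring.
Qed.

Lemma hgw_INR_0 B m : (B < m)%nat -> hgw (INR B) m = 0.
Proof. intros H. unfold hgw. rewrite poch_opp_INR_0 by exact H. unfold Rdiv; ring. Qed.

(** Downward induction from [q = B], where only the term [m = B] survives. The boundary term
    vanishes since [w_(B+1) = 0], and the remaining recurrence in [q] is that of [hgw_S] up to sign.
    For [q > B] both sides are [0]. *)
Lemma gauss_sum_INR_neg B q :
  sum_n (fun m => hgw (INR B) m * rfact m q) B = (-1) ^ (B + q) * hgw (INR B) q :> R.
Proof.
  destruct (le_lt_dec q B) as [Hq|Hq].
  - remember (B - q)%nat as d eqn:Hd. revert q Hq Hd.
    induction d as [|d IH]; intros q Hq Hd.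
    + replace q with B by lia. replace (B + B)%nat with (2 * B)%nat by lia.
      rewrite pow_1_even. destruct B as [|B].
      * rewrite sum_O. unfold rfact; simpl. field.
      * rewrite sum_n_S. rewrite (sum_n_Rext _ (fun _ => 0)).
        -- rewrite sum_n_const. unfold rfact. rewrite Nat.leb_refl, Nat.sub_diag. simpl (INR (fact 0)). field.
        -- intros m Hm. unfold rfact. destruct (Nat.leb_spec (S B) m); [lia|ring].
    + pose proof (rfact_telescope (INR B) q B) as HT.
      rewrite (hgw_INR_0 B (S B)) in HT by lia.
      rewrite (IH (S q)) in HT by lia.
      pose proof (hgw_S (INR B) q) as HS.
      assert (Hlt : INR q + 1 <= INR B) by (rewrite <- S_INR; apply le_INR; lia).
      pose proof (pos_INR q).
      apply Rmult_eq_reg_l with (INR q * (INR q + 1) - INR B * (INR B + 1)); [|nra].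
      rewrite Nat.add_succ_r in HT. simpl pow in HT.
      transitivity ((-1) ^ (B + q) * (hgw (INR B) (S q) * (INR q + 1))); [lra|].
      rewrite HS. ring.
  - rewrite hgw_INR_0 by exact Hq. rewrite (sum_n_Rext _ (fun _ => 0)).
    + rewrite sum_n_const. ring.
    + intros m Hm. unfold rfact. destruct (Nat.leb_spec q m); [lia|ring].
Qed.

(** The boundary term vanishes, so [p = 0] gives [0] at once, and the value [0] is passed upward as
    long as [p(p+1)] differs from [B(B+1)]. *)
Lemma gauss_sum_INR_pos B p : (p < B)%nat ->
  sum_n (fun m => hgw (INR B) m / INR (fact (m + S p))) B = 0 :> R.
Proof.
  induction p as [|p IH]; intros Hp.
  - pose proof (gauss_telescope (INR B) 0 B) as H.
    rewrite (hgw_INR_0 B (S B)) in H by lia. simpl (INR 0) in H.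
    assert (0 < INR B) by (apply lt_0_INR; lia).
    apply Rmult_eq_reg_l with (0 * (0 + 1) - INR B * (INR B + 1)); [|nra].
    unfold Rdiv in *. rewrite Rmult_0_r in *. lra.
  - pose proof (gauss_telescope (INR B) (S p) B) as H.
    rewrite (hgw_INR_0 B (S B)) in H by lia. rewrite IH in H by lia.
    assert (INR (S p) + 1 <= INR B) by (rewrite <- S_INR; apply le_INR; lia).
    pose proof (pos_INR (S p)).
    apply Rmult_eq_reg_l with (INR (S p) * (INR (S p) + 1) - INR B * (INR B + 1)); [|nra].
    unfold Rdiv in *. rewrite !Rmult_0_r in *. lra.
Qed.

(** The guard makes terms with [j > i] vanish, where truncated subtraction would give [w_0 = 1]. *)
Definition hgw_shift (b : R) (i j : nat) : R := if j <=? i then hgw b (i - j) else 0.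

(** Only [j - k] matters on the left: for [j <= k] it is [gauss_sum_INR_neg] at [k - j], otherwise
    [gauss_sum_INR_pos] at [j - k - 1], which is below [B]. *)
Lemma gauss_sum_INR B j k : (0 < j <= B)%nat ->
  sum_n (fun m => hgw (INR B) m * rfact (m + j) k) B
  = (-1) ^ (B + j + k) * hgw_shift (INR B) k j :> R.
Proof.
  intros Hj. unfold hgw_shift. destruct (Nat.leb_spec j k) as [H|H].
  - replace (B + j + k)%nat with (B + (k - j) + 2 * j)%nat by lia.
    rewrite pow_add, pow_1_even, Rmult_1_r, <- gauss_sum_INR_neg.
    apply sum_n_Rext. intros m _. f_equal. unfold rfact.
    destruct (Nat.leb_spec k (m + j)), (Nat.leb_spec (k - j) m); try lia; [|reflexivity].
    replace (m - (k - j))%nat with (m + j - k)%nat by lia. reflexivity.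
  - rewrite Rmult_0_r.
    rewrite <- (gauss_sum_INR_pos B (j - k - 1)) by lia.
    apply sum_n_Rext. intros m _. unfold Rdiv. f_equal.
    replace (m + j)%nat with (m + S (j - k - 1) + k)%nat by lia. apply rfact_add.
Qed.

(** * The second identity *)

Lemma sum_n_zero_tail (f : nat -> R) N M :
  (forall j, (N < j)%nat -> f j = 0) -> (N <= M)%nat -> sum_n f M = sum_n f N :> R.
Proof.
  intros Hf H. induction H as [|M H IH]; [reflexivity|].
  rewrite sum_n_S, IH, Hf by lia. ring.
Qed.

Lemma is_series_finite (f : nat -> R) N :
  (forall j, (N < j)%nat -> f j = 0) -> is_series f (sum_n f N).
Proof.
  intros Hf. change (is_lim_seq (sum_n f) (sum_n f N)).
  apply is_lim_seq_ext_loc with (fun _ => sum_n f N).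
  - exists N. intros M HM. symmetry. apply sum_n_zero_tail; assumption.
  - apply is_lim_seq_const.
Qed.

Lemma sum_n_zero_head (f : nat -> R) k :
  (forall i, (i < S k)%nat -> f i = 0) -> sum_n f k = 0 :> R.
Proof.
  intros Hf. rewrite (sum_n_Rext _ (fun _ => 0)).
  - rewrite sum_n_const. ring.
  - intros i Hi. apply Hf. lia.
Qed.

(** Brings the sums starting at [i = j] and at [i = k] to the common starting point [0]. *)
Lemma is_series_shift (f : nat -> R) k l :
  (forall i, (i < k)%nat -> f i = 0) ->
  is_series f l <-> is_series (fun m => f (m + k)%nat) l.
Proof.
  intros Hf. destruct k as [|k].
  - split; apply is_series_ext; intros; rewrite Nat.add_0_r; reflexivity.
  - assert (H0 : sum_n f k = 0 :> R) by (apply sum_n_zero_head, Hf).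
    split; intros H.
    + apply is_series_ext with (fun m => f (S k + m)%nat).
      { intros m. f_equal. lia. }
      apply is_series_incr_n; [lia|].
      replace (plus _ _) with l; [exact H|].
      change (l = l + sum_n f k :> R). rewrite H0. symmetry. apply Rplus_0_r.
    + apply is_series_decr_n with (S k); [lia|].
      replace (plus _ _) with l by (change (l = l - sum_n f k :> R); rewrite H0; symmetry; apply Rminus_0_r).
      apply is_series_ext with (fun m => f (m + S k)%nat); [|exact H].
      intros m. f_equal. lia.
Qed.

Lemma is_series_sum_n (f : nat -> nat -> R) (l : nat -> R) B :
  (forall j, (j <= B)%nat -> is_series (f j) (l j)) ->
  is_series (fun i => sum_n (fun j => f j i) B) (sum_n l B).
Proof.
  induction B as [|B IH]; intros H.
  - apply is_series_ext with (f 0%nat); [intros; rewrite sum_O; reflexivity|].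
    rewrite sum_O. apply H; lia.
  - apply is_series_ext with (fun i => plus (sum_n (fun j => f j i) B) (f (S B) i)).
    { intros i. rewrite sum_n_S. reflexivity. }
    rewrite sum_n_S. apply (is_series_plus (V := R_NormedModule)); [apply IH; intros|]; apply H; lia.
Qed.

Lemma gbinom_INR_0 n m : (n < m)%nat -> gbinom (INR n) m = 0.
Proof.
  intros H. unfold gbinom. rewrite falling_poch, poch_opp_INR_0 by exact H.
  unfold Rdiv; ring.
Qed.

(** A range of [j] independent of [i], so that the sum over [i] can be taken inside: [hgw_shift]
    cuts off large [j] when [i] is small, and [binom(n+1, j) = 0] for [j > n + 1] when [i] is
    large. *)
Lemma acoef_INR n i x : (0 < i)%nat ->
  acoef (INR n) i x =
  sum_n (fun j => - (gbinom (INR n + 1) j * x ^ S j)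
     * (hgw_shift (INR (n + 2)) i (S j) / INR (fact i))) (n + 1).
Proof.
  intros Hi. destruct i as [|N]; [lia|].
  set (f := fun j => - (gbinom (INR n + 1) j * x ^ S j)
     * (hgw_shift (INR (n + 2)) (S N) (S j) / INR (fact (S N)))).
  transitivity (sum_n f N).
  - rewrite acoef_S. apply sum_n_Rext. intros j Hj. unfold f, hgw_shift.
    destruct (Nat.leb_spec (S j) (S N)); [|lia].
    replace (S N - S j)%nat with (N - j)%nat by lia.
    rewrite plus_INR. reflexivity.
  - destruct (le_lt_dec N (n + 1)).
    + symmetry. apply sum_n_zero_tail; [|assumption]. intros j Hj. unfold f, hgw_shift.
      destruct (Nat.leb_spec (S j) (S N)); [lia|]. unfold Rdiv; ring.
    + apply sum_n_zero_tail; [|lia]. intros j Hj. unfold f.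
      replace (INR n + 1) with (INR (n + 1)) by (rewrite plus_INR; reflexivity).
      rewrite gbinom_INR_0 by exact Hj. ring.
Qed.

Lemma is_series_rfact_hgw B j k : (0 < j <= B)%nat ->
  is_series (fun i => rfact i k * hgw_shift (INR B) i j)
    ((-1) ^ (B + j + k) * hgw_shift (INR B) k j).
Proof.
  intros Hj. rewrite <- gauss_sum_INR by exact Hj.
  apply (is_series_shift _ j).
  - intros i Hi. unfold hgw_shift. destruct (Nat.leb_spec j i); [lia|ring].
  - apply is_series_ext with (fun m => hgw (INR B) m * rfact (m + j) k).
    + intros m. unfold hgw_shift. destruct (Nat.leb_spec j (m + j)); [|lia].
      replace (m + j - j)%nat with m by lia. apply Rmult_comm.
    + apply is_series_finite. intros m Hm. rewrite hgw_INR_0 by exact Hm. ring.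
Qed.

(** Since [binom(i,k) / i! = 1 / (k! (i-k)!)], each power of [x] carries a sum from
    [is_series_rfact_hgw] with [B = n + 2]. Its sign splits into [(-1)^(n+k)] and a part that
    replaces [x] by [-x]. *)
Lemma acoef_INR_binomial_series n k x : (1 <= k)%nat ->
  is_series (fun m => Binomial.C (m + k) k * acoef (INR n) (m + k) x)
    ((-1) ^ (n + k) * acoef (INR n) k (- x)).
Proof.
  intros Hk.
  set (v := fun j => - (gbinom (INR n + 1) j * x ^ S j) / INR (fact k)).
  pose proof (is_series_sum_n
    (fun j i => v j * (rfact i k * hgw_shift (INR (n + 2)) i (S j)))
    (fun j => v j * ((-1) ^ (n + 2 + S j + k) * hgw_shift (INR (n + 2)) k (S j))) (n + 1)
    (fun j Hj => is_series_scal_l (v j) _ _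
       (is_series_rfact_hgw (n + 2) (S j) k ltac:(lia)))) as H.
  assert (HS : sum_n (fun j => v j * ((-1) ^ (n + 2 + S j + k) * hgw_shift (INR (n + 2)) k (S j))) (n + 1)
     = (-1) ^ (n + k) * acoef (INR n) k (- x)).
  { rewrite acoef_INR by lia.
    etransitivity; [|apply sum_n_Rmult_l].
    apply sum_n_Rext. intros j _. unfold v.
    replace (n + 2 + S j + k)%nat with (n + k + S j + 2 * 1)%nat by lia.
    rewrite pow_add, pow_1_even, pow_add.
    replace (- x) with (-1 * x) by ring. rewrite Rpow_mult_distr.
    unfold Rdiv. ring. }
  rewrite HS in H.
  apply (is_series_shift _ k) in H.
  - eapply is_series_ext; [|exact H]. intros m. cbv beta. rewrite acoef_INR by lia.
    etransitivity; [|apply sum_n_Rmult_l].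
    apply sum_n_Rext. intros j _. unfold v, Binomial.C.
    rewrite rfact_add. replace (m + k - k)%nat with m by lia.
    field. repeat split; apply INR_fact_neq_0.
  - intros i Hi. cbv beta. rewrite (sum_n_Rext _ (fun _ => 0)).
    + rewrite sum_n_const. ring.
    + intros j _. unfold rfact. destruct (Nat.leb_spec k i); [lia|]. ring.
Qed.

Theorem theorem2 (al : R) (Hal : -1 < al) :
  (forall x : R,
     is_series (fun n : nat => acoef al (S n) x)
       (- (sin (PI * al) / PI) * (x / ((al + 2) * (al + 3)))
          * hyp1F1 1 (al + 4) (- x))) /\
  (forall n : nat, al = INR n ->
     forall (k : nat) (x : R), (1 <= k)%nat ->
       is_series (fun m : nat => Binomial.C (m + k) k * acoef al (m + k) x)
         ((-1) ^ (n + k) * acoef al k (- x))).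
Proof.
  split.
  - intros x. apply acoef_series, Hal.
  - intros n -> k x Hk. apply acoef_INR_binomial_series, Hk.
Qed.
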